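(* Let each $f_i:\mathbb{R}^d\to\mathbb{R}$ ($i=1,\dots,m$) be $\mu$-strongly convex and $L$-smooth, let $\kappa=L/\mu$, and let $G:\mathbb{R}^d\to\mathbb{R}\cup\{\pm\infty\}$ be proper, closed and convex. Let $x^\star\in\mathbb{R}^d$ be the optimal solution of $$\min_{x\in\mathbb{R}^d}\ \frac1m\sum_{i=1}^m f_i(x)+G(x).$$ Let $A\in\mathbb{R}^{m\times m}$, $B\in\mathbb{S}^m$, $C\in\mathbb{S}^m_+$ satisfy all of the following: (a) $\mathrm{null}(C)=\mathrm{span}(1)$; (b) $1^\top A\,1=m$ and $1^\top B=1^\top$; (c) $A=BD$ for some $D\in\mathbb{S}^m$ with $-I\prec D\preceq I$; (d) $0\prec I-C$; (e) $B$ and $C$ commute; (f) $B^2\prec \dfrac{(L+\mu)^2}{\left(L\lambda_{\max}(D)-\mu\lambda_{\min}(D)\right)^2}\,(I-C)$. Suppose in addition that $B^2\preceq I-C$ and $A=B$, so that $D=I$ and the optimal step-size $\gamma^\star=\frac{\lambda_{\max}(D)+\lambda_{\min}(D)}{L+\mu}$ equals $\frac{2}{L+\mu}$. Let $\{(X^k,Z^k,Y^k)\}_{k\ge0}$ be generated by $$X^k=\mathrm{prox}_{\gamma g}(Z^k),\qquad Z^{k+1}=AX^k-\gamma B\nabla f(X^k)-Y^k,\qquad Y^{k+1}=Y^k+CZ^{k+1},$$ with $\gamma=\gamma^\star=\frac{2}{L+\mu}$, from any $Z^0\in\mathbb{R}^{m\times d}$ and any $Y^0\in\mathbb{R}^{m\times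 d}$ whose columns lie in the range of $C$. Then $\|X^k-1x^{\star\top}\|^2=\mathcal{O}(\lambda^k)$, where the rate $$\lambda=\max\left(q^2\lambda_{\max}\!\left(B^2(I-C)^{-1}\right),\ 1-\lambda_2(C)\right),\qquad q=\max\left(|\lambda_{\min}(D)-\gamma L|,\ |\lambda_{\max}(D)-\gamma\mu|\right),$$ reduces to $$\lambda=\max\left\{\left(\frac{\kappa-1}{\kappa+1}\right)^2,\ 1-\lambda_2(C)\right\}.$$
   Context: $m$ is the number of agents and $0<\mu\le L$; $L$-smooth means differentiable with $L$-Lipschitz gradient. $\mathbb{S}^m$ is the set of real symmetric $m\times m$ matrices, $\mathbb{S}^m_+$ the positive semidefinite ones; $\prec,\preceq$ denote the Loewner order. $1\in\mathbb{R}^m$ is the all-ones column vector and $I$ the identity. Eigenvalues of a symmetric matrix are arranged in increasing order $\lambda_1\le\lambda_2\le\dots\le\lambda_m$, and $\lambda_{\min},\lambda_{\max}$ denote the smallest and largest. $\|\cdot\|$ is the Frobenius norm on $\mathbb{R}^{m\times d}$. For $X=[x_1,\dots,x_m]^\top\in\mathbb{R}^{m\times d}$ (row $i$ is $x_i^\top$ with $x_i\in\mathbb{R}^d$), set $f(X)=\sum_{i=1}^m f_i(x_i)$, $g(X)=\sum_{i=1}^m G(x_i)$, and $\nabla f(X)=[\nabla f_1(x_1),\dots,\nabla f_m(x_m)]^\top\in\mathbb{R}^{m\times d}$. The proximal operator is $\mathrm{prox}_{\gamma g}(Z)=\arg\min_{Y\in\mathbb{R}^{m\times d}}\ g(Y)+\frac{1}{2\gamma}\|Z-Y\|^2$.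 *)

(* Defs.v *)
From HB Require Import structures.
From mathcomp Require Import all_boot all_order all_algebra.
From mathcomp Require Import all_classical all_reals all_analysis.

Set Implicit Arguments.
Unset Strict Implicit.
Unset Printing Implicit Defensive.

Import Order.TTheory GRing.Theory Num.Theory.
Import numFieldNormedType.Exports.

Local Open Scope classical_set_scope.
Local Open Scope ring_scope.

(* The library norm `|M| on matrices is the sup norm, hence this definition; on
   row vectors it is the Euclidean norm. *)
Definition frobenius {R : realType} {m n : nat} (M : 'M[R]_(m, n)) : R :=
  Num.sqrt (\sum_(i < m) \sum_(j < n) M i j ^+ 2).

Definition ones {R : realType} {m : nat} : 'cV[R]_m := const_mx 1.

Definition psdmx {R : realType} {m : nat} (M : 'M[R]_m) : Prop :=
  M \is symmetricmx /\ forall v : 'cV[R]_m, 0 <= (v^T *m M *m v) 0 0.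

Definition pdmx {R : realType} {m : nat} (M : 'M[R]_m) : Prop :=
  M \is symmetricmx /\
  forall v : 'cV[R]_m, v != 0 -> 0 < (v^T *m M *m v) 0 0.

Definition loewner_le {R : realType} {m : nat} (M N : 'M[R]_m) : Prop :=
  psdmx (N - M).

Definition loewner_lt {R : realType} {m : nat} (M N : 'M[R]_m) : Prop :=
  pdmx (N - M).

(* The eigenvalues of M with multiplicity, in increasing order. The list is
   unique when it exists, and it exists for every symmetric M; it is [::] by
   convention if the characteristic polynomial of M does not split over R. *)
Definition spectrum {R : realType} {m : nat} (M : 'M[R]_m) : seq R :=
  xget [::] [set s : seq R | sorted <=%R s /\
                             char_poly M = \prod_(a <- s) ('X - a%:P)].

(* Eigenvalues are numbered from 1. *)
Definition eigen {R : realType} {m : nat} (k : nat) (M : 'M[R]_m) : R :=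
  nth 0 (spectrum M) k.-1.

Definition eigen_min {R : realType} {m : nat} (M : 'M[R]_m) : R := eigen 1 M.

Definition eigen_max {R : realType} {m : nat} (M : 'M[R]_m) : R := eigen m M.

(* Points of R^d are row vectors, so that x_i is literally row i of X. *)
Definition gradient {R : realType} {d : nat} (f : 'rV[R]_d -> R)
    (x : 'rV[R]_d) : 'rV[R]_d :=
  \row_(j < d) 'D_(delta_mx 0 j) (f : 'rV[R]_d -> R^o) x.

Definition smooth {R : realType} {d : nat} (L : R) (f : 'rV[R]_d -> R) : Prop :=
  (forall x : 'rV[R]_d, differentiable (f : 'rV[R]_d -> R^o) x) /\
  (forall x y : 'rV[R]_d,
     frobenius (gradient f x - gradient f y) <= L * frobenius (x - y)).

Definition strongly_convex {R : realType} {d : nat} (mu : R)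
    (f : 'rV[R]_d -> R) : Prop :=
  @convex_function R 'rV[R]_d setT
    (fun x : 'rV[R]_d => f x - mu / 2 * frobenius x ^+ 2).

Definition epigraph {R : realType} {d : nat} (G : 'rV[R]_d -> \bar R) :
  set ('rV[R]_d * R^o) := [set p | (G p.1 <= p.2%:E)%E].

Definition proper_function {R : realType} {d : nat} (G : 'rV[R]_d -> \bar R) :
  Prop := (forall x, G x != -oo%E) /\ (exists x, G x != +oo%E).

Definition closed_function {R : realType} {d : nat} (G : 'rV[R]_d -> \bar R) :
  Prop := closed (epigraph G).

Definition convex_efunction {R : realType} {d : nat} (G : 'rV[R]_d -> \bar R) :
  Prop := @convex_set R ('rV[R]_d * R^o)%type (epigraph G).

Definition argmin {R : realType} {T : Type} (F : T -> \bar R) : set T :=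
  [set x | forall y, (F x <= F y)%E].

Definition prox {R : realType} {m d : nat} (gamma : R)
    (g : 'M[R]_(m, d) -> \bar R) (Z : 'M[R]_(m, d)) : set 'M[R]_(m, d) :=
  argmin (fun Y => g Y + ((2 * gamma)^-1 * frobenius (Z - Y) ^+ 2)%:E)%E.

Definition rowsum {R : realType} {m d : nat} (G : 'rV[R]_d -> \bar R)
    (X : 'M[R]_(m, d)) : \bar R :=
  (\sum_(i < m) G (row i X))%E.

Definition stacked_gradient {R : realType} {m d : nat}
    (f : 'I_m -> 'rV[R]_d -> R) (X : 'M[R]_(m, d)) : 'M[R]_(m, d) :=
  \matrix_(i < m, j < d) gradient (f i) (row i X) 0 j.

(* Main.v *)
(* The errors z, w, p of Z^k, X^k - gamma grad f(X^k) and of a preimage of Y^k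
   under C obey z+ = B w - C p and p+ = p + z+. Nonexpansiveness of the proximal
   operator and cocoercivity of the gradients give |w|^2 <= q^2 |z|^2 with
   q = (kappa - 1) / (kappa + 1). Writing S = I - C, the relation
   S z+ + C p+ = B w and B S^-1 B <= I give
     |z+|^2 + <C p+, S^-1 C p+> + <p+, C p+> <= |w|^2 + <p, C p>,
   and on the range of C one has S^-1 >= 1 / (1 - l2), so that
   |z|^2 + <p, C p> / (1 - l2) contracts by the factor max(q^2, 1 - l2). Since
   the all-ones vector is fixed by B and by S, the largest eigenvalue of
   B^2 S^-1 is exactly 1. *)
Require Import Defs.
From HB Require Import structures.
From mathcomp Require Import all_boot all_order all_algebra.
From mathcomp Require Import all_classical all_reals all_analysis.
From mathcomp Require Import ring lra.
From mathcomp Require Import complex.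

Set Implicit Arguments.
Unset Strict Implicit.
Unset Printing Implicit Defensive.

Import Order.TTheory GRing.Theory Num.Theory.
Import numFieldNormedType.Exports.

Local Open Scope classical_set_scope.
Local Open Scope ring_scope.

(** * Spectral theorem for real symmetric matrices *)

Lemma symmetric_tr (R : fieldType) n (N : 'M[R]_n) :
  (N \is symmetricmx) = (N^T == N).
Proof. by rewrite is_hermitianmxE expr0 scale1r map_mx_id// eq_sym. Qed.

Lemma char_poly_conj (R : comUnitRingType) n (P A : 'M[R]_n) :
  P \in unitmx -> char_poly (invmx P *m A *m P) = char_poly A.
Proof.
move=> Pu; have PuX : map_mx polyC (invmx P) *m map_mx polyC P = 1%:M.
  by rewrite -map_mxM mulVmx// map_mx1.
have -> : char_poly (invmx P *m A *m P) =
   \det (map_mx polyC (invmx P) *m char_poly_mx A *m map_mx polyC P).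
  rewrite /char_poly; congr (\det _).
  rewrite /char_poly_mx mulmxBr mulmxBl !map_mxM; congr (_ - _).
  by rewrite scalar_mxC -mulmxA PuX mulmx1.
by rewrite !det_mulmx mulrC mulrA -det_mulmx (mulmx1C PuX) det1 mul1r.
Qed.

Section spectral.
Local Open Scope sesquilinear_scope.

(** Over [R[i]] the matrix is Hermitian, so it is unitarily diagonalizable with real spectrum. The
    factorization of the characteristic polynomial then descends to [R] because the embedding of
    polynomials is injective. *)
Lemma symmetric_unitary_diag (R : rcfType) n (N : 'M[R]_n) :
  N \is symmetricmx ->
  exists (P : 'M[R[i]]_n) (r : 'I_n -> R),
   [/\ P \is unitarymx,
       map_mx (real_complex R) N
         = invmx P *m diag_mx (\row_i real_complex R (r i)) *m P
     & char_poly N = \prod_i ('X - (r i)%:P)].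
Proof.
move=> Nsym; set NC := map_mx _ N.
have NCherm : NC \is hermsymmx.
  apply: realsym_hermsym.
    by move: Nsym; rewrite !symmetric_tr map_trmx => /eqP->.
  by apply/mxOverP => i j; rewrite mxE complex_real.
have /mxOverP sp_real := hermitian_spectral_diag_real NCherm.
have /orthomx_spectralP NCE := hermitian_normalmx NCherm.
exists (spectralmx NC), (fun i => complex.Re (spectral_diag NC 0 i)).
have diagE : \row_i real_complex R (complex.Re (spectral_diag NC 0 i))
    = spectral_diag NC.
  by apply/rowP => i; rewrite mxE RRe_real.
split; [exact: spectral_unitarymx|by rewrite diagE|].
apply: (map_poly_inj (real_complex R)).
rewrite map_char_poly -/NC {1}NCE char_poly_conj ?spectral_unit//.
rewrite char_poly_trig ?diag_mx_is_trig// rmorph_prod; apply: eq_bigr => i _.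
by rewrite rmorphB/= map_polyX map_polyC/= mxE eqxx mulr1n RRe_real.
Qed.

(** In the complex eigenbasis coordinates [w = P v] the quadratic form is the sum of
    [r i * |w i|^2]. *)
Lemma psdmx_eigenvalue (R : realType) n (N : 'M[R]_n) : N \is symmetricmx ->
  (forall a, eigenvalue N a -> 0 <= a) -> psdmx N.
Proof.
move=> Nsym Nev; split=> // v.
have [P [r [Pu NE cpN]]] := symmetric_unitary_diag Nsym.
have r_ge0 i : 0 <= r i.
  apply: Nev; rewrite eigenvalue_root_char cpN; apply/rootP.
  by rewrite horner_prod (bigD1 i)//= !hornerE subrr mul0r.
rewrite -(@lecR R).
pose w := P *m map_mx (real_complex R) v.
suff -> : real_complex R ((v^T *m N *m v) 0 0)
    = \sum_i real_complex R (r i) * `|w i 0| ^+ 2.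
  by apply: sumr_ge0 => i _; rewrite mulr_ge0 ?exprn_ge0// lecR.
set NC := map_mx _ N in NE *; set vC := map_mx _ v in w *.
have vCE : map_mx (real_complex R) v^T = vC ^t*.
  by apply/matrixP => i j; rewrite !mxE conj_Creal// complex_real.
set D := diag_mx _ in NE.
have NCE : map_mx (real_complex R) (v^T *m N *m v) = w ^t* *m D *m w.
  rewrite 2!map_mxM vCE -/NC -/vC NE (invmx_unitary Pu) /w trmx_mul map_mxM.
  by rewrite !mulmxA.
have /matrixP/(_ 0 0) := NCE; rewrite mxE => ->; clearbody w.
rewrite mul_mx_diag mxE; apply: eq_bigr => i _.
by rewrite !mxE mulrAC mulrC normCKC.
Qed.

End spectral.

(** * The Frobenius inner product *)

Definition mdot {R : realType} {m n : nat} (M N : 'M[R]_(m, n)) : R :=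
  \tr (M^T *m N).

Section mdot.
Context {R : realType}.
Implicit Types m n : nat.

Lemma mdotE m n (M N : 'M[R]_(m, n)) :
  mdot M N = \sum_i \sum_j M i j * N i j.
Proof.
rewrite exchange_big/=; apply: eq_bigr => j _.
by rewrite mxE; apply: eq_bigr => i _; rewrite mxE.
Qed.

Lemma mdotC m n (M N : 'M[R]_(m, n)) : mdot M N = mdot N M.
Proof. by rewrite /mdot -mxtrace_tr trmx_mul trmxK. Qed.

Lemma mdotDr m n (M N P : 'M[R]_(m, n)) : mdot M (N + P) = mdot M N + mdot M P.
Proof. by rewrite /mdot mulmxDr mxtraceD. Qed.

Lemma mdotZr m n (a : R) (M N : 'M[R]_(m, n)) : mdot M (a *: N) = a * mdot M N.
Proof. by rewrite /mdot -scalemxAr mxtraceZ. Qed.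

Lemma mdotNr m n (M N : 'M[R]_(m, n)) : mdot M (- N) = - mdot M N.
Proof. by rewrite -scaleN1r mdotZr mulN1r. Qed.

Lemma mdotDl m n (M N P : 'M[R]_(m, n)) : mdot (M + N) P = mdot M P + mdot N P.
Proof. by rewrite mdotC mdotDr !(mdotC P). Qed.

Lemma mdotZl m n (a : R) (M N : 'M[R]_(m, n)) : mdot (a *: M) N = a * mdot M N.
Proof. by rewrite mdotC mdotZr mdotC. Qed.

Lemma mdotNl m n (M N : 'M[R]_(m, n)) : mdot (- M) N = - mdot M N.
Proof. by rewrite mdotC mdotNr mdotC. Qed.

Lemma mdot0r m n (M : 'M[R]_(m, n)) : mdot M 0 = 0.
Proof. by rewrite /mdot mulmx0 mxtrace0. Qed.

Definition mdotL := (@mdotDl, @mdotDr, @mdotZl, @mdotZr, @mdotNl, @mdotNr).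

Lemma mdot_mull m n p (S : 'M[R]_(m, p)) (M : 'M[R]_(p, n)) (N : 'M[R]_(m, n)) :
  mdot (S *m M) N = mdot M (S^T *m N).
Proof. by rewrite /mdot trmx_mul mulmxA. Qed.

Lemma mdot_sym m n (S : 'M[R]_m) (M N : 'M[R]_(m, n)) : S \is symmetricmx ->
  mdot (S *m M) N = mdot M (S *m N).
Proof. by rewrite symmetric_tr => /eqP SE; rewrite mdot_mull SE. Qed.

Lemma frobenius_sqr m n (M : 'M[R]_(m, n)) : frobenius M ^+ 2 = mdot M M.
Proof.
rewrite sqr_sqrtr ?mdotE//.
by apply: sumr_ge0 => i _; apply: sumr_ge0 => j _; rewrite sqr_ge0.
Qed.

Lemma frobenius_ge0 m n (M : 'M[R]_(m, n)) : 0 <= frobenius M.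
Proof. exact: sqrtr_ge0. Qed.

Lemma frobeniusZ m n (a : R) (M : 'M[R]_(m, n)) :
  frobenius (a *: M) = `|a| * frobenius M.
Proof.
rewrite /frobenius -sqrtr_sqr -sqrtrM ?sqr_ge0//; congr Num.sqrt.
rewrite mulr_sumr; apply: eq_bigr => i _; rewrite mulr_sumr.
by apply: eq_bigr => j _; rewrite mxE exprMn.
Qed.

Lemma mdot_ge0 m n (M : 'M[R]_(m, n)) : 0 <= mdot M M.
Proof. by rewrite -frobenius_sqr sqr_ge0. Qed.

Lemma mdot_eq0 m n (M : 'M[R]_(m, n)) : mdot M M = 0 -> M = 0.
Proof.
rewrite mdotE pair_bigA/= => /eqP; rewrite psumr_eq0 => [/allP M0|]; last first.
  by move=> [i j] _; rewrite -expr2 sqr_ge0.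
apply/matrixP => i j; have /= := M0 (i, j) (mem_index_enum _).
by rewrite mulf_eq0 orbb mxE => /eqP.
Qed.

(** With [a = |M|] and [b = |N|], expanding [|b M - a N|^2 >= 0] gives [2 a b (a b - <M, N>) >= 0];
    when [a b = 0] one of the matrices vanishes. *)
Lemma CauchySchwarz_mdot m n (M N : 'M[R]_(m, n)) :
  mdot M N <= frobenius M * frobenius N.
Proof.
set a := frobenius M; set b := frobenius N.
have aM : a ^+ 2 = mdot M M by rewrite frobenius_sqr.
have bN : b ^+ 2 = mdot N N by rewrite frobenius_sqr.
have a0 : 0 <= a by exact: frobenius_ge0.
have b0 : 0 <= b by exact: frobenius_ge0.
have := mdot_ge0 (b *: M - a *: N).
rewrite !mdotL (mdotC N M) -aM -bN => h.
have {h} h : 0 <= 2 * (a * b) * (a * b - mdot M N) by apply: le_trans h _; lra.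
have [ab0|ab0] := ltP 0 (a * b).
  by rewrite pmulr_rge0 ?subr_ge0// in h; rewrite mulr_gt0.
have /eqP : a * b = 0 by apply/le_anti; rewrite ab0 mulr_ge0.
rewrite mulf_eq0 => /orP[] /eqP z0; rewrite z0 ?(mul0r, mulr0).
- have /mdot_eq0 -> : mdot M M = 0 by rewrite -aM z0 expr0n.
  by rewrite mdotC mdot0r.
- have /mdot_eq0 -> : mdot N N = 0 by rewrite -bN z0 expr0n.
  by rewrite mdot0r.
Qed.

Lemma mdot_row m n (M N : 'M[R]_(m, n)) :
  mdot M N = \sum_i mdot (row i M) (row i N).
Proof.
rewrite mdotE; apply: eq_bigr => i _; rewrite mdotE big_ord1.
by apply: eq_bigr => j _; rewrite !mxE.
Qed.

(** Transfers [psdmx], which tests single column vectors, to iterates with [n] columns. *)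
Lemma mdot_colE m n (S : 'M[R]_m) (M : 'M[R]_(m, n)) :
  mdot M (S *m M) = \sum_j ((col j M)^T *m S *m col j M) 0 0.
Proof.
rewrite /mdot mulmxA; apply: eq_bigr => j _; rewrite !mxE.
apply: eq_bigr => i _; rewrite !mxE; congr (_ * _).
by apply: eq_bigr => k _; rewrite !mxE.
Qed.

Lemma mdot_cV m (S : 'M[R]_m) (v : 'cV[R]_m) :
  (v^T *m S *m v) 0 0 = mdot v (S *m v).
Proof. by rewrite /mdot mulmxA /mxtrace big_ord1. Qed.

Lemma mdot_psd m n (S : 'M[R]_m) (M : 'M[R]_(m, n)) :
  psdmx S -> 0 <= mdot M (S *m M).
Proof. by move=> [_ Sp]; rewrite mdot_colE; apply: sumr_ge0 => j _. Qed.

End mdot.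

(** * Ordered eigenvalues of a symmetric matrix *)

Section spectrum.
Context {R : realType} {n : nat} (N : 'M[R]_n) (Nsym : N \is symmetricmx).

(** The default value of [spectrum] is ruled out by a witness: the sorted diagonal of the unitary
    diagonalization. *)
Lemma spectrumP : sorted <=%R (spectrum N) /\
  char_poly N = \prod_(a <- spectrum N) ('X - a%:P).
Proof.
have [P [r [_ _ cpN]]] := symmetric_unitary_diag Nsym.
have h : [set s : seq R | sorted <=%R s /\
    char_poly N = \prod_(a <- s) ('X - a%:P)] (sort <=%R (codom r)).
  split; first exact/sort_sorted/le_total.
  by rewrite cpN (perm_big _ (permEl (perm_sort _ _)))/= /codom big_image.
exact: (xgetI [::] h).
Qed.

Lemma size_spectrum : size (spectrum N) = n.
Proof.
have [_ h] := spectrumP.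
apply/eqP; rewrite -eqSS -(size_prod_XsubC _ (@id R))/= -h.
by rewrite size_char_poly.
Qed.

Lemma mem_spectrum a : (a \in spectrum N) = eigenvalue N a.
Proof.
by rewrite eigenvalue_root_char (proj2 spectrumP) root_prod_XsubC.
Qed.

Lemma eigenvalue_eigen k : (0 < k <= n)%N -> eigenvalue N (eigen k N).
Proof.
case: k => // k /= kn.
by rewrite -mem_spectrum /eigen mem_nth// size_spectrum.
Qed.

Lemma eigenvalueE a : eigenvalue N a ->
  exists2 k, (0 < k <= n)%N & a = eigen k N.
Proof.
rewrite -mem_spectrum => aN; exists (index a (spectrum N)).+1.
  by rewrite /= -[X in (_ < X)%N]size_spectrum index_mem.
by rewrite /eigen nth_index.
Qed.

Lemma le_eigen j k : (0 < j)%N -> (j <= k)%N -> (k <= n)%N ->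
  eigen j N <= eigen k N.
Proof.
case: j k => [|j] [|k]// _; rewrite ltnS => jk kn.
have := sorted_leq_nth le_trans le_refl 0 (proj1 spectrumP).
by apply => //; rewrite inE size_spectrum// (leq_ltn_trans jk).
Qed.

Lemma eigen_max_eq b : (0 < n)%N -> eigenvalue N b ->
  (forall a, eigenvalue N a -> a <= b) -> eigen_max N = b.
Proof.
move=> n0 Nb Nle; apply/le_anti; rewrite Nle ?eigenvalue_eigen ?n0 ?leqnn//=.
by have [k /andP[k0 kn] ->] := eigenvalueE Nb; exact: le_eigen.
Qed.

(** [eigenvalue] refers to row eigenvectors; symmetry of [N] lets transposition turn them into
    columns. *)
Lemma eigenvector_col a : eigenvalue N a ->
  exists2 v : 'cV[R]_n, N *m v = a *: v & v != 0.
Proof.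
move=> /eigenvalueP[v vN v0]; exists v^T; last by rewrite trmx_eq0.
by move: Nsym; rewrite symmetric_tr => /eqP {1}<-; rewrite -trmx_mul vN linearZ.
Qed.

Lemma col_eigenvector a (v : 'cV[R]_n) : N *m v = a *: v -> v != 0 ->
  eigenvalue N a.
Proof.
move=> Nv v0; apply/eigenvalueP; exists v^T; last by rewrite trmx_eq0.
by move: Nsym; rewrite symmetric_tr => /eqP {1}<-; rewrite -trmx_mul Nv linearZ.
Qed.

End spectrum.

(** * Definite matrices, Loewner order and the all-ones vector *)

Section gossip.
Context {R : realType}.
Implicit Types n d : nat.

Lemma ones_tr_mul n d (M : 'M[R]_(n, d)) (j : 'I_d) :
  (ones^T *m M) 0 j = \sum_i M i j.
Proof. by rewrite mxE; apply: eq_bigr => i _; rewrite !mxE mul1r. Qed.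

Lemma ones_tr_ones n : ones^T *m (ones : 'cV[R]_n) = n%:R%:M :> 'M[R]_1.
Proof.
apply/matrixP => i j; rewrite !ord1 ones_tr_mul mxE mulr1n.
under eq_bigr do rewrite mxE.
by rewrite sumr_const card_ord.
Qed.

Lemma symmetricmxD n (M N : 'M[R]_n) :
  M \is symmetricmx -> N \is symmetricmx -> M + N \is symmetricmx.
Proof. by rewrite !symmetric_tr linearD/= => /eqP-> /eqP->. Qed.

Lemma symmetricmxZ n (a : R) (M : 'M[R]_n) :
  M \is symmetricmx -> a *: M \is symmetricmx.
Proof. by rewrite !symmetric_tr linearZ/= => /eqP->. Qed.

Lemma symmetricmx_scalar n (a : R) : (a%:M : 'M[R]_n) \is symmetricmx.
Proof. by rewrite symmetric_tr tr_scalar_mx. Qed.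

Lemma psdmx_eigenvalue_ge0 n (N : 'M[R]_n) a :
  psdmx N -> eigenvalue N a -> 0 <= a.
Proof.
move=> [Nsym N0] /(eigenvector_col Nsym)[v Nv v0]; have := N0 v.
rewrite mdot_cV Nv mdotZr; apply: contraTT; rewrite -!ltNge => a0.
rewrite nmulr_rlt0// lt_def mdot_ge0 andbT; apply: contraNneq v0.
by move=> /mdot_eq0 ->.
Qed.

Lemma mdot_gt0 n d (M : 'M[R]_(n, d)) : M != 0 -> 0 < mdot M M.
Proof.
move=> M0; rewrite lt_def mdot_ge0 andbT; apply: contraNneq M0.
by move=> /mdot_eq0 ->.
Qed.

Lemma loewner_le_mdot n d (M N : 'M[R]_n) (X : 'M[R]_(n, d)) :
  loewner_le M N -> mdot X (M *m X) <= mdot X (N *m X).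
Proof.
move=> /(mdot_psd X); rewrite mulmxBl mdotDr mdotNr subr_ge0; exact.
Qed.

Lemma pdmx_psdmx n (S : 'M[R]_n) : pdmx S -> psdmx S.
Proof.
move=> [Ssym S0]; split=> // v; have [->|/S0/ltW//] := eqVneq v 0.
by rewrite mulmx0 mxE.
Qed.

Lemma pdmx_unit n (S : 'M[R]_n) : pdmx S -> S \in unitmx.
Proof.
move=> [Ssym S0]; rewrite -row_free_unit; apply/inj_row_free => v vS.
apply/eqP; apply: contraT => v0.
by have := S0 v^T; rewrite trmx_eq0 trmxK vS mul0mx mxE ltxx => /(_ v0).
Qed.

Lemma invmx_sym n (S : 'M[R]_n) : S \is symmetricmx -> invmx S \is symmetricmx.
Proof. by rewrite !symmetric_tr trmx_inv => /eqP->. Qed.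

Lemma invmx_comm n (S B : 'M[R]_n) : S \in unitmx -> B *m S = S *m B ->
  B *m invmx S = invmx S *m B.
Proof.
move=> Su BS; rewrite -[LHS]mul1mx -(mulVmx Su) -!mulmxA; congr (_ *m _).
by rewrite mulmxA -BS mulmxK.
Qed.

Lemma eigen_scalar1 n k : (0 < k <= n)%N -> eigen k (1%:M : 'M[R]_n) = 1.
Proof.
move=> kn; have [v] := eigenvector_col (symmetricmx_scalar n 1)
  (eigenvalue_eigen (symmetricmx_scalar n 1) kn).
rewrite mul1mx -{1}[v]scale1r => /eqP; rewrite -subr_eq0 -scalerBl scaler_eq0.
by move=> /orP[|/eqP->]; [rewrite subr_eq0 => /eqP|rewrite eqxx].
Qed.

(* Schur complement: both [B^2 <= S] and [B S^-1 B <= 1] say that the block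
   matrix [[1, B], [B, S]] is positive semidefinite. *)
Lemma loewner_schur n d (B S : 'M[R]_n) (W : 'M[R]_(n, d)) :
  B \is symmetricmx -> S \in unitmx -> loewner_le (B *m B) S ->
  mdot (B *m W) (invmx S *m (B *m W)) <= mdot W W.
Proof.
move=> Bsym Su BS; set U := invmx S *m (B *m W).
have SU : S *m U = B *m W by rewrite mulKVmx.
have BU : mdot (B *m U) (B *m U) <= mdot (B *m W) U.
  rewrite -SU mdotC (mdot_sym _ _ Bsym) mulmxA.
  exact: (loewner_le_mdot _ BS).
(* Here [|W|^2 - 2 <B W, U> + |B U|^2 >= 0], and the last term is at most [<B W, U>]. *)
have := mdot_ge0 (W - B *m U).
rewrite !mdotL (mdotC W (B *m U)) (mdot_sym _ _ Bsym) (mdotC U).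
by move: BU; rewrite (mdot_sym _ _ Bsym); lra.
Qed.

(** Commutation makes the product symmetric and identifies its quadratic form with the one bounded
    in [loewner_schur], so no eigenvalue exceeds 1; [ones] is an eigenvector for 1. *)
Lemma eigen_max_schur n (B S : 'M[R]_n) : (0 < n)%N ->
  B \is symmetricmx -> pdmx S -> loewner_le (B *m B) S ->
  B *m S = S *m B -> B *m ones = ones -> S *m ones = ones ->
  eigen_max (B *m B *m invmx S) = 1.
Proof.
move=> n0 Bsym Spd BS comm B1 S1; have Su := pdmx_unit Spd.
have commV := invmx_comm Su comm.
have BBsym : B *m B *m invmx S \is symmetricmx.
  have /eqP SVE : (invmx S)^T == invmx S.
    by rewrite -symmetric_tr invmx_sym//; case: Spd.
  move: Bsym; rewrite !symmetric_tr !trmx_mul SVE => /eqP->.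
  by rewrite mulmxA -commV -(mulmxA B (invmx S)) -commV mulmxA.
apply: eigen_max_eq => //.
- apply: (@col_eigenvector _ _ _ BBsym 1 ones).
    rewrite scale1r -!mulmxA.
    have -> : invmx S *m ones = ones :> 'cV[R]_n by rewrite -{1}S1 mulKmx.
    by rewrite !B1.
  apply/eqP => /matrixP/(_ (Ordinal n0) 0); rewrite !mxE => /eqP.
  by rewrite oner_eq0.
- move=> a /(eigenvector_col BBsym)[v Mv v0].
  have := loewner_schur v Bsym Su BS; rewrite (mdot_sym _ _ Bsym).
  rewrite !mulmxA -(mulmxA B) -commV mulmxA Mv mdotZr.
  by rewrite ger_pMl// mdot_gt0.
Qed.

End gossip.

(** * Spectral gap of [C] on the orthogonal complement of [ones] *)

Section consensus.
Context {R : realType} {n : nat} (C : 'M[R]_n).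
Hypotheses (n_gt1 : (1 < n)%N) (C_psd : psdmx C).
Hypothesis kerC :
  forall v : 'cV[R]_n, C *m v = 0 <-> exists a : R, v = a *: ones.

Let n_neq0 : n%:R != 0 :> R.
Proof. by rewrite pnatr_eq0 -lt0n ltnW. Qed.

Lemma mul_ones0 : C *m ones = 0.
Proof. by apply/kerC; exists 1; rewrite scale1r. Qed.

(* Reduces to [C + l (1 1^T / n) - l I] being positive semidefinite, where [l]
   is the second eigenvalue: this only needs its eigenvalues to be nonnegative,
   not an orthonormal eigenbasis of [C]. *)
Lemma eigen2_gap d (M : 'M[R]_(n, d)) : ones^T *m M = 0 ->
  eigen 2 C * mdot M M <= mdot M (C *m M).
Proof.
move=> M1; have [Csym _] := C_psd; set l := eigen 2 C.
pose J : 'M[R]_n := ones *m ones^T.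
pose N := C + (l / n%:R) *: J + (- l)%:M.
have Jsym : J \is symmetricmx by rewrite symmetric_tr trmx_mul trmxK.
have Nsym : N \is symmetricmx.
  by rewrite !symmetricmxD ?symmetricmxZ ?symmetricmx_scalar.
have N1 : N *m ones = 0.
  rewrite !mulmxDl mul_ones0 add0r -scalemxAl -mulmxA ones_tr_ones.
  rewrite mul_mx_scalar scalerA divfK// mul_scalar_mx -scalerDl subrr.
  exact: scale0r.
suff : psdmx N.
  move=> /(mdot_psd M); rewrite !mulmxDl -scalemxAl -mulmxA M1 mulmx0 scaler0.
  by rewrite addr0 mul_scalar_mx !mdotL mulNr subr_ge0.
apply: psdmx_eigenvalue => // a /(eigenvector_col Nsym)[v Nv v0].
rewrite leNgt; apply/negP => a0.
(* [N] is symmetric and kills [ones], so eigenvectors for the nonzero value [a] are orthogonal to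
   [ones]. *)
have v1 : ones^T *m v = 0.
  have : ones^T *m (N *m v) = 0.
    move: Nsym; rewrite symmetric_tr => /eqP NE.
    by rewrite mulmxA -NE -trmx_mul N1 trmx0 mul0mx.
  rewrite Nv -scalemxAr => /eqP; rewrite scaler_eq0 lt_eqF//=.
  by move/eqP.
have Cv : C *m v = (a + l) *: v.
  move: Nv; rewrite !mulmxDl -scalemxAl -mulmxA v1 mulmx0 scaler0 addr0.
  by rewrite mul_scalar_mx scaleNr scalerDl => /(canRL (subrK _)).
(* Otherwise [v] lies in the kernel of [C]: it is a multiple of [ones] and orthogonal to it, hence
   zero. *)
have aln0 : a + l != 0.
  apply: contraNneq v0 => al0; move: Cv; rewrite al0 scale0r => /kerC[b vE].
  move: v1; rewrite vE -scalemxAr ones_tr_ones scale_scalar_mx.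
  move=> /matrixP/(_ 0 0); rewrite !mxE mulr1n => /eqP.
  rewrite mulf_eq0 (negbTE n_neq0) orbF => /eqP->.
  by rewrite scale0r.
have Cal := col_eigenvector Csym Cv v0.
(* [a + l] is an eigenvalue of [C]. If it is the first, it is at most the eigenvalue 0, against
   positivity and [aln0]; if it comes later, it is at least [l], against [a < 0]. *)
have [[|[|k]]// /andP[_ kn] alE] := eigenvalueE Csym Cal.
- have C0 : eigenvalue C 0.
    apply: (col_eigenvector Csym (v := ones)); rewrite ?mul_ones0 ?scale0r//.
    apply: contraTneq n_gt1 => /matrixP/(_ (Ordinal (ltnW n_gt1)) 0).
    by rewrite !mxE => /eqP; rewrite oner_eq0.
  have [j /andP[j0 jn] jE] := eigenvalueE Csym C0.
  have : eigen 1 C <= 0 by rewrite jE; exact: le_eigen.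
  rewrite -alE => al_le0; have := psdmx_eigenvalue_ge0 C_psd Cal.
  by move: aln0; rewrite eq_le al_le0 => /negP.
- have : l <= a + l by rewrite alE; exact: le_eigen.
  by rewrite lerDr leNgt a0.
Qed.

Lemma eigen2_ge0 : 0 <= eigen 2 C.
Proof.
by apply/(psdmx_eigenvalue_ge0 C_psd)/eigenvalue_eigen => //; case: C_psd.
Qed.

Lemma eigen2_lt1 : pdmx (1%:M - C) -> eigen 2 C < 1.
Proof.
have [Csym _] := C_psd => -[_ S0].
have [|v Cv v0] := @eigenvector_col _ _ _ Csym (eigen 2 C).
  exact: eigenvalue_eigen.
have := S0 v v0; rewrite mdot_cV mulmxBl mul1mx Cv !mdotL.
by rewrite -[X in X - _]mul1r -mulrBl pmulr_lgt0 ?mdot_gt0// subr_gt0.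
Qed.

(** The range of the symmetric [C] is the orthogonal complement of its kernel. Row-space inclusion
    is tested against the cokernel of [C], whose columns are killed by [C] and are therefore
    multiples of [ones]. *)
Lemma consensus_range d (M : 'M[R]_(n, d)) : ones^T *m M = 0 ->
  exists P, M = C *m P.
Proof.
move=> M1; have [Csym _] := C_psd.
have : (M^T <= C)%MS.
  rewrite submxE; apply/eqP/matrixP => i j; rewrite [RHS]mxE.
  have /kerC[b bE] : C *m col j (cokermx C) = 0.
    by rewrite colE mulmxA mulmx_coker mul0mx.
  have -> : (M^T *m cokermx C) i j = (M^T *m col j (cokermx C)) i 0.
    by move: (cokermx C) => K; rewrite colE mulmxA -colE [RHS]mxE.
  rewrite bE -scalemxAr -[M^T *m ones]trmxK trmx_mul trmxK M1 trmx0 scaler0.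
  by rewrite mxE.
move=> /submxP[D MD]; exists D^T.
move: Csym; rewrite symmetric_tr => /eqP {1}<-.
by rewrite -trmx_mul -MD trmxK.
Qed.

End consensus.

(** * Gradients and the quadratic bounds of smooth functions *)

Section smooth.
Context {R : realType} {d : nat}.
Implicit Types (f : 'rV[R]_d -> R) (x v : 'rV[R]_d).

Lemma gradientE f x v : differentiable (f : 'rV[R]_d -> R^o) x ->
  'D_v (f : 'rV[R]_d -> R^o) x = mdot (gradient f x) v.
Proof.
move=> fx; rewrite deriveE// {1}(row_sum_delta v) linear_sum mdotE big_ord1.
apply: eq_bigr => j _; rewrite linearZ/= mxE deriveE//.
exact: mulrC.
Qed.

Lemma is_derive_line f x v (t : R) :
  differentiable (f : 'rV[R]_d -> R^o) (x + t *: v) ->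
  is_derive t 1 (fun s : R => f (x + s *: v) : R^o)
    (mdot (gradient f (x + t *: v)) v).
Proof.
move=> fx.
have quotE : (fun h : R => h^-1 *: (((fun s : R => f (x + s *: v) : R^o) \o
      shift t) (h *: 1) - f (x + t *: v)))
    = (fun h : R => h^-1 *: (((f : 'rV[R]_d -> R^o) \o shift (x + t *: v))
        (h *: v) - f (x + t *: v))).
  apply/funext => h /=; congr (_ *: (f _ - _)).
  by rewrite scalerDl [h%:A]mulr1 addrCA.
apply: DeriveDef.
  by rewrite /derivable quotE; exact: diff_derivable.
by rewrite /derive quotE -[LHS]/('D_v (f : 'rV[R]_d -> R^o) _) gradientE.
Qed.

(** Taking [e = 1] or [e = -1] yields the upper or the lower quadratic bound from a single proof by
    the mean value theorem. *)
Lemma smooth_bound (L e : R) f x v : smooth L f -> e ^+ 2 = 1 ->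
  e * (f (x + v) - f x - mdot (gradient f x) v) <= L / 2 * mdot v v.
Proof.
move=> [fd fL] e1; set c := mdot (gradient f x) v; set n := mdot v v.
(* The quadratic correction is chosen so that the Lipschitz bound on the gradient forces [dchi <= 0]
   on the unit interval. *)
pose chi (t : R) : R := e * f (x + t *: v) - e * c * t - L / 2 * n * t ^+ 2.
pose dchi (t : R) : R :=
  e * mdot (gradient f (x + t *: v)) v - e * c - L * n * t.
have dchiE (t : R) : is_derive t 1 (chi : R -> R^o) (dchi t).
  have df := is_derive_line (fd (x + t *: v)).
  have did : is_derive t 1 (id : R -> R^o) 1 by exact: is_derive_id.
  have dsq := @is_deriveX _ _ _ 2 _ _ _ did.
  have := is_deriveB (is_deriveB (is_deriveZ e df) (is_deriveZ (e * c) did))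
    (is_deriveZ (L / 2 * n) dsq).
  rewrite (_ : _ - _ = dchi t)//.
  rewrite /dchi; move: (mdot _ v) => g.
  by rewrite /GRing.scale/= /GRing.scale/= expr1 mulr1; field.
have chi_cont : {within `[0, 1], continuous chi}.
  by apply: derivable_within_continuous => t _; case: (dchiE t).
have [a + chiE] := MVT ltr01 (fun t _ => dchiE t) chi_cont.
rewrite in_itv/= => /andP[a0 a1].
have gL : dchi a <= 0.
  have -> : dchi a = mdot (gradient f (x + a *: v) - gradient f x) (e *: v)
      - L * n * a.
    by rewrite /dchi /c !mdotL; move: (mdot _ _) (mdot _ _) => g h; ring.
  have e_norm : `|e| = 1 by rewrite -sqrtr_sqr e1 sqrtr1.
  rewrite subr_le0 (le_trans (CauchySchwarz_mdot _ _))//.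
  rewrite frobeniusZ e_norm mul1r.
  rewrite /n -frobenius_sqr; have := fL (x + a *: v) x.
  rewrite [x + _]addrC addrK frobeniusZ gtr0_norm// => h.
  have -> : L * frobenius v ^+ 2 * a = L * (a * frobenius v) * frobenius v.
    by ring.
  by rewrite ler_wpM2r// frobenius_ge0.
move: chiE; rewrite /chi scale0r scale1r addr0 => chiE.
have -> : e * (f (x + v) - f x - c) = dchi a + L / 2 * n by lra.
by rewrite gerDr.
Qed.
End smooth.

(** Replaces the passage to the limit [t -> 0] in first-order arguments. If [b < a], the choice
    [t = min(1, (a - b) / (|k| + 1))] gives a contradiction. *)
Lemma ler_addgt0_mulr (R : realFieldType) (a b k : R) :
  (forall t, 0 < t -> t <= 1 -> a <= b + t * k) -> a <= b.
Proof.
move=> h; rewrite leNgt; apply/negP => ba.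
pose K := `|k| + 1; have K0 : 0 < K by rewrite ltr_pwDr.
have abK : 0 < (a - b) / K by rewrite divr_gt0// subr_gt0.
pose t := Num.min 1 ((a - b) / K).
have t0 : 0 < t by rewrite lt_min ltr01.
have tle : t * K <= a - b by rewrite -ler_pdivlMr// ge_min lexx orbT.
have := h t t0; rewrite ge_min lexx => /(_ isT) abk.
have : t * k < t * K by rewrite ltr_pM2l// ltr_pwDr// ler_norm.
lra.
Qed.

Lemma conv_line (R : numDomainType) (V : lmodType R) (t : R) (t0 : 0 <= t)
    (t1 : t <= 1) (x y : V) :
  conv (Itv01 t0 t1) (x : convex_lmodType V) (y : convex_lmodType V)
    = y + t *: (x - y).
Proof.
rewrite [LHS](_ : _ = t *: x + (1 - t) *: y)// scalerBl scale1r scalerBr.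
by rewrite addrCA addrA.
Qed.

(** * Cocoercivity of the gradient and contraction of the gradient step *)

Section cocoercive.
Context {R : realType} {d : nat} (mu L : R) (f : 'rV[R]_d -> R).
Hypotheses (mu_gt0 : 0 < mu) (mu_le_L : mu <= L).
Hypotheses (f_sconvex : strongly_convex mu f) (f_smooth : smooth L f).
Implicit Types x y v : 'rV[R]_d.

Lemma smooth_upper x v :
  f (x + v) <= f x + mdot (gradient f x) v + L / 2 * mdot v v.
Proof. by have := smooth_bound x v f_smooth (expr1n _ 2); lra. Qed.

Lemma sconvex_lower x v :
  f x + mdot (gradient f x) v + mu / 2 * mdot v v <= f (x + v).
Proof.
set c := mdot (gradient f x) v; set n := mdot v v.
suff : c <= f (x + v) - f x - mu / 2 * n by lra.
(* Strong convexity bounds [f (x + t v)] above by the chord and smoothness bounds it below by the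
   tangent. The two terms of the constant are the [t^2] remainders of these bounds, left after
   division by [t]. *)
apply: (@ler_addgt0_mulr _ _ _ (mu / 2 * n + L / 2 * n)) => t t0 t1.
rewrite -(ler_pM2l t0).
have := f_sconvex (Itv01 (ltW t0) t1) (mem_setT (x + v)) (mem_setT x).
rewrite !frobenius_sqr convRE /=.
rewrite conv_line addrAC subrr add0r.
have sqrN1 : (-1) ^+ 2 = 1 :> R by rewrite sqrrN expr1n.
have := smooth_bound x (t *: v) f_smooth sqrN1.
rewrite /unstable.onem !mdotL (mdotC v x) -/c -/n.
move: (f (x + t *: v)) (f (x + v)) (f x) (mdot x x) (mdot x v) => a b e p q.
clearbody c n; clear -t0; lra.
Qed.

(* Compare the lower bound of [f] from [x] and the upper bound from [y] at the
   point [y + tau h]; [h] is the gradient increment of [f - mu / 2 |.|^2]. *)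
Lemma sconvex_smooth_gap x y h (tau : R) :
  h = gradient f x - gradient f y - mu *: (x - y) ->
  f x - f y - mdot (gradient f x) (x - y) + mu / 2 * mdot (x - y) (x - y)
    + tau * mdot h h - (L - mu) / 2 * tau ^+ 2 * mdot h h <= 0.
Proof.
move=> hE; have := smooth_upper y (tau *: h).
have := sconvex_lower x (y + tau *: h - x).
have -> : y + tau *: h - x = tau *: h - (x - y) by rewrite opprB addrAC addrC.
have -> : x + (tau *: h - (x - y)) = y + tau *: h.
  by rewrite opprB addrCA subrKC addrC.
have : mdot (gradient f x) h - mdot (gradient f y) h
    = mdot h h + mu * mdot (x - y) h.
  have gE : gradient f x - gradient f y = h + mu *: (x - y) by rewrite hE subrK.
  by rewrite -mdotNl -mdotDl gE; move: (x - y) => dl; rewrite !mdotL.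
move: {hE} (x - y) (f (y + _)) => dl w.
move: (gradient f x) (gradient f y) => p q pqE.
rewrite !mdotL (mdotC h dl); move: pqE.
move: (mdot p h) (mdot q h) (mdot h h) (mdot dl h) (mdot p dl) (mdot dl dl).
move=> ph qh hh dh pd dd pqE; have -> : ph = hh + mu * dh + qh by lra.
lra.
Qed.

(** Adding the gap inequality to its copy with [x] and [y] exchanged cancels the function values.
    [tau] stays free so that [L = mu] is covered too. *)
Lemma sconvex_smooth_cocoercive x y h (tau : R) :
  h = gradient f x - gradient f y - mu *: (x - y) ->
  (2 * tau - (L - mu) * tau ^+ 2) * mdot h h <= mdot h (x - y).
Proof.
move=> hE; have := sconvex_smooth_gap tau hE.
have /(sconvex_smooth_gap tau) :
    - h = gradient f y - gradient f x - mu *: (y - x).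
  by rewrite hE -[gradient f y - _]opprB -[y - x]opprB scalerN -opprD.
have -> : mdot h (x - y) = mdot (gradient f x) (x - y)
    - mdot (gradient f y) (x - y) - mu * mdot (x - y) (x - y).
  by rewrite hE; move: (x - y) => dl; rewrite !mdotL.
rewrite -[y - x]opprB.
move: {hE} (x - y) (gradient f x) (gradient f y) => dl p q.
rewrite !(mdotNl, mdotNr) !opprK; lra.
Qed.

Lemma sconvex_smooth_coercive x y :
  mdot (gradient f x - gradient f y) (gradient f x - gradient f y)
    + L * mu * mdot (x - y) (x - y)
  <= (L + mu) * mdot (gradient f x - gradient f y) (x - y).
Proof.
have := @sconvex_smooth_cocoercive x y.
move: (x - y) (gradient f x - _) => dl g /(_ _ _ erefl).
have -> : mdot g g + L * mu * mdot dl dl = (L + mu) * mdot g dl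
    + (mdot (g - mu *: dl) (g - mu *: dl) - (L - mu) * mdot (g - mu *: dl) dl).
  by rewrite !mdotL (mdotC dl g); ring.
move: (g - mu *: dl) => h gap; rewrite gerDl subr_le0.
have hh0 := mdot_ge0 h.
(* For [mu < L] the optimal choice is [tau = 1 / (L - mu)]. *)
have [Lmu|Lmu] := ltP 0 (L - mu).
  have -> : mdot h h = (L - mu) *
      ((2 * (L - mu)^-1 - (L - mu) * (L - mu)^-1 ^+ 2) * mdot h h).
    by field; rewrite gt_eqF.
  by rewrite ler_pM2l.
have Lmu0 : L - mu = 0 by move: mu_le_L Lmu; lra.
rewrite Lmu0 mul0r; move: hh0; rewrite le_eqVlt => /predU1P[<-//|hh0].
(* For [L = mu] the bound is linear in [tau]; if [h] were nonzero, this [tau] would give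
   [<h, dl> + 1 <= <h, dl>]. *)
have := gap ((mdot h dl + 1) / 2 / mdot h h).
rewrite Lmu0 mul0r subr0.
have -> : 2 * ((mdot h dl + 1) / 2 / mdot h h) * mdot h h = mdot h dl + 1.
  by field; rewrite gt_eqF.
have := gap 0; lra.
Qed.

(** For this step-size the left side minus the right side is exactly [4 / (L + mu)^2] times the
    difference of the two sides of [sconvex_smooth_coercive]. *)
Lemma gradient_step_contraction x y (gamma := 2 / (L + mu)) :
  mdot (x - gamma *: gradient f x - (y - gamma *: gradient f y))
       (x - gamma *: gradient f x - (y - gamma *: gradient f y))
  <= ((L - mu) / (L + mu)) ^+ 2 * mdot (x - y) (x - y).
Proof.
have := sconvex_smooth_coercive x y.
have -> : x - gamma *: gradient f x - (y - gamma *: gradient f y)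
    = (x - y) - gamma *: (gradient f x - gradient f y).
  by rewrite scalerBr !opprD !opprK addrACA.
move: (x - y) (gradient f x - _) => dl g; rewrite /gamma => co.
have Lmu0 : 0 < L + mu by move: mu_gt0 mu_le_L; lra.
rewrite !mdotL (mdotC g dl) -subr_le0.
set lhs := (X in X <= 0).
have -> : lhs = 4 / (L + mu) ^+ 2 *
   (mdot g g + L * mu * mdot dl dl - (L + mu) * mdot g dl).
  by rewrite /lhs (mdotC dl g); field; rewrite gt_eqF.
by rewrite pmulr_rle0 ?subr_le0// divr_gt0// exprn_gt0.
Qed.

End cocoercive.

(** * Variational inequalities for minimizers and proximal points *)

Section proximal.
Context {R : realType}.

(** Compare [X] with [X + t (Y - X)], divide by [t] and let [t] tend to 0; [p] stands for the
    gradient of [F] at [X]. This serves both the original problem and the proximal step. *)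
Lemma argmin_variational m d (F : 'M[R]_(m, d) -> R)
    (g : 'M[R]_(m, d) -> \bar R) (X p : 'M[R]_(m, d)) (K : R) :
  (forall V, F (X + V) <= F X + mdot p V + K * mdot V V) ->
  (forall Y a b t, g X = a%:E -> g Y = b%:E -> 0 < t -> t <= 1 ->
     (g (X + t *: (Y - X))%R <= (a + t * (b - a))%:E)%E) ->
  (forall Y, g Y != -oo%E) ->
  argmin (fun Y => (F Y)%:E + g Y)%E X ->
  forall Y b, g Y = b%:E -> exists2 a, g X = a%:E & a <= b + mdot p (Y - X).
Proof.
move=> Fle gconv gNy Xmin Y b gY.
have [a gX] : exists a, g X = a%:E.
  have := Xmin Y; rewrite gY; move: (gNy X).
  case: (g X) => [a||]// _ _.
  by exists a.
exists a => //.
apply: (@ler_addgt0_mulr _ _ _ (K * mdot (Y - X) (Y - X))) => t t0 t1.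
rewrite -(ler_pM2l t0).
have := le_trans (Xmin (X + t *: (Y - X)))
  (leeD2l _ (gconv _ _ _ _ gX gY t0 t1)).
rewrite gX -!EFinD lee_fin.
have := Fle (t *: (Y - X)); rewrite !(mdotZl, mdotZr); lra.
Qed.

Lemma convex_efunction_line d (G : 'rV[R]_d -> \bar R) (x y : 'rV[R]_d)
    (a b t : R) : convex_efunction G ->
  (G x <= a%:E)%E -> (G y <= b%:E)%E -> 0 <= t -> t <= 1 ->
  (G (x + t *: (y - x))%R <= (a + t * (b - a))%:E)%E.
Proof.
move=> Gconv Gx Gy t0 t1.
have := Gconv (y, b) (x, a) (Itv01 t0 t1).
rewrite conv_line !inE => h; exact: (h Gy Gx).
Qed.

Lemma rowsum_fin m d (G : 'rV[R]_d -> \bar R) (X : 'M[R]_(m, d))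
    (a : 'I_m -> R) :
  (forall i, G (row i X) = (a i)%:E) -> rowsum G X = (\sum_i a i)%:E.
Proof. by move=> Ga; rewrite /rowsum -sumEFin; apply: eq_bigr. Qed.

Lemma rowsumP m d (G : 'rV[R]_d -> \bar R) (X : 'M[R]_(m, d)) (c : R) :
  (forall x, G x != -oo%E) -> rowsum G X = c%:E ->
  exists2 a, forall i, G (row i X) = (a i)%:E & c = \sum_i a i.
Proof.
move=> GNy GX.
have Gfin i : G (row i X) \is a fin_num.
  have : rowsum G X \is a fin_num by rewrite GX.
  by move=> /sum_fin_numP; apply=> //; exact: mem_index_enum.
exists (fun i => fine (G (row i X))) => [i|]; first by rewrite fineK.
apply: EFin_inj; rewrite -GX -sumEFin; apply: eq_bigr => i _.
by rewrite fineK.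
Qed.

Lemma rowsumNy m d (G : 'rV[R]_d -> \bar R) (X : 'M[R]_(m, d)) :
  (forall x, G x != -oo%E) -> rowsum G X != -oo%E.
Proof.
by move=> GNy; rewrite esum_eqNy; apply/existsPn => i; rewrite GNy.
Qed.

Lemma prox_variational m d (gamma : R) (G : 'rV[R]_d -> \bar R)
    (Z X Y : 'M[R]_(m, d)) (b : R) :
  0 < gamma -> proper_function G -> convex_efunction G ->
  prox gamma (rowsum G) Z X -> rowsum G Y = b%:E ->
  exists2 a, rowsum G X = a%:E & a <= b - gamma^-1 * mdot (Z - X) (Y - X).
Proof.
move=> g0 [GNy _] Gconv XZ GY.
have [||||a GX aY] := @argmin_variational _ _
    (fun Y => (2 * gamma)^-1 * frobenius (Z - Y) ^+ 2) (rowsum G) X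
    (* The gradient at [X] of the proximal quadratic, followed by its exact second-order
       coefficient. *)
    (- gamma^-1 *: (Z - X)) (2 * gamma)^-1 _ _ _ _ Y b GY.
- move=> V; rewrite !frobenius_sqr opprD addrA.
  move: (Z - X) => W; rewrite !mdotL (mdotC V W) invfM; lra.
- move=> Y' a b' t /(rowsumP GNy)[al Gal ->] /(rowsumP GNy)[be Gbe ->] t0 t1.
  rewrite /rowsum.
  apply: (@le_trans _ _ (\sum_i (al i + t * (be i - al i))%:E)%E).
    apply: lee_sum => i _; rewrite linearD/= linearZ/= linearB/=.
    by apply: convex_efunction_line; rewrite ?Gal ?Gbe// ltW.
  by rewrite sumEFin lee_fin big_split/= -mulr_sumr sumrB.
- by move=> Y'; exact: rowsumNy.
- by move=> Y'; rewrite addeC [leRHS]addeC; exact: XZ.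
- by exists a; rewrite // -mulNr -mdotZl.
Qed.

End proximal.

(** * One-step decrease of the Lyapunov function *)

Section lyapunov.
Context {R : realType} {n d : nat} (B C : 'M[R]_n).
Hypotheses (n_gt1 : (1 < n)%N) (C_psd : psdmx C).
Hypothesis kerC :
  forall v : 'cV[R]_n, C *m v = 0 <-> exists a : R, v = a *: ones.
Hypotheses (S_pd : pdmx (1%:M - C)) (B_sym : B \is symmetricmx).
Hypothesis B2_le : loewner_le (B *m B) (1%:M - C).
Implicit Types P W Z : 'M[R]_(n, d).

Let l := eigen 2 C.
Let S := 1%:M - C.
Let Csym : C \is symmetricmx. Proof. by case: C_psd. Qed.
Let Ssym : S \is symmetricmx. Proof. by case: S_pd. Qed.
Let l_ge0 : 0 <= l. Proof. exact: eigen2_ge0. Qed.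
Let l_lt1 : l < 1. Proof. exact: eigen2_lt1. Qed.

Lemma ones_tr_mulC (M : 'M[R]_(n, d)) : ones^T *m (C *m M) = 0.
Proof.
have /eqP CE : C^T == C by rewrite -symmetric_tr.
by rewrite mulmxA -{1}CE -trmx_mul (mul_ones0 kerC) trmx0 mul0mx.
Qed.

(** Removing the column means of [P] changes neither side, so [eigen2_gap] applies to [P0]; combine
    it, multiplied by [l], with [|C P0 - l P0|^2 >= 0]. *)
Lemma eigen2_range P : l * mdot P (C *m P) <= mdot (C *m P) (C *m P).
Proof.
pose P0 := P - n%:R^-1 *: (ones *m (ones^T *m P)).
have P01 : ones^T *m P0 = 0.
  rewrite mulmxBr -scalemxAr (mulmxA ones^T) ones_tr_ones mul_scalar_mx.
  rewrite scalerA mulVf.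
    by rewrite scale1r subrr.
  by rewrite pnatr_eq0 -lt0n ltnW.
have CP0 : C *m P0 = C *m P.
  rewrite mulmxBr -scalemxAr (mulmxA C) (mul_ones0 kerC).
  by rewrite mul0mx scaler0 subr0.
have -> : mdot P (C *m P) = mdot P0 (C *m P0).
  by rewrite -[in LHS]CP0 -(mdot_sym _ _ Csym) -CP0 (mdot_sym _ _ Csym).
have gap := eigen2_gap n_gt1 C_psd kerC P01.
clearbody P0; have := mdot_ge0 (C *m P0 - l *: P0).
rewrite -CP0 !mdotL (mdotC (C *m P0) P0).
have := ler_wpM2l l_ge0 gap; rewrite -/l; lra.
Qed.

(** Inverts the bound [<M, S M> <= (1 - l) |M|^2] by expanding the [S]-quadratic form at
    [(1 - l) S^-1 M - M], which is nonnegative. *)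
Lemma resolvent_range (M : 'M[R]_(n, d)) : ones^T *m M = 0 ->
  mdot M M <= (1 - l) * mdot M (invmx S *m M).
Proof.
move=> M1; have Su := pdmx_unit S_pd.
set U := invmx S *m M; have SU : S *m U = M by rewrite mulKVmx.
have l1 : 0 < 1 - l by rewrite subr_gt0.
have := mdot_psd ((1 - l) *: U - M) (pdmx_psdmx S_pd).
have SM : mdot M (S *m M) <= (1 - l) * mdot M M.
  have := eigen2_gap n_gt1 C_psd kerC M1.
  by rewrite mulmxBl mul1mx !mdotL -/l; lra.
rewrite -/S mulmxBr -scalemxAr SU !mdotL -(mdot_sym _ _ Ssym) SU (mdotC U M).
set a := mdot M U => h.
rewrite -subr_ge0 -(pmulr_rge0 _ l1); move: h SM; lra.
Qed.

(* The Lyapunov function [|Z|^2 + <P, C P> / (1 - l)]; for [Y = C P] the second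
   summand is the squared norm of [Y] for the pseudo-inverse of [C]. *)
Lemma lyapunov_step P W Z : Z = B *m W - C *m P ->
  mdot Z Z + (1 - l)^-1 * mdot (P + Z) (C *m (P + Z))
    <= mdot W W + mdot P (C *m P).
Proof.
move=> ZE; have Su := pdmx_unit S_pd; set Q := P + Z.
set Y := C *m Q; pose U := invmx S *m Y.
have l1 : 0 < 1 - l by rewrite subr_gt0.
have SU : S *m U = Y by rewrite mulKVmx.
have BW : B *m W = S *m Z + Y.
  by rewrite /Y mulmxBl mul1mx mulmxDr [_ + C *m Z]addrC addrA subrK ZE subrK.
have SBW : invmx S *m (B *m W) = Z + U by rewrite BW mulmxDr mulKmx.
have := loewner_schur W B_sym Su B2_le; rewrite -/S SBW BW.
have -> : mdot (S *m Z + Y) (Z + U)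
    = mdot Z (S *m Z) + 2 * mdot Z Y + mdot Y U.
  rewrite !mdotL !(mdot_sym _ _ Ssym) SU (mdotC Y Z); ring.
have -> : mdot Z (S *m Z) = mdot Z Z - mdot Z (C *m Z).
  by rewrite mulmxBl mul1mx !mdotL.
have -> : mdot P (C *m P) = mdot Q Y - 2 * mdot Z Y + mdot Z (C *m Z).
  have -> : P = Q - Z by rewrite addrK.
  rewrite mulmxBr -/Y; clearbody Q.
  rewrite !mdotL -(mdot_sym Q Z Csym) -/Y (mdotC Y Z); ring.
(* Chains [l <Q, C Q> <= |C Q|^2 <= (1 - l) <Y, S^-1 Y>]; this upgrades the coefficient of
   [<Q, C Q>] from 1 to [1 / (1 - l)]. *)
have YU : l / (1 - l) * mdot Q Y <= mdot Y U.
  rewrite mulrAC ler_pdivrMr// [leRHS]mulrC.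
  apply: le_trans (resolvent_range (ones_tr_mulC Q)).
  exact: eigen2_range.
have -> : (1 - l)^-1 = 1 + l / (1 - l) by field; rewrite gt_eqF.
lra.
Qed.

End lyapunov.

(** * Optimality of the consensus point and the linear rate *)

Lemma row_ones (R : realType) (m d : nat) (v : 'rV[R]_d) (i : 'I_m) :
  row i (ones *m v) = v.
Proof. by apply/rowP => j; rewrite !mxE big_ord1 !mxE mul1r. Qed.

Lemma argmin_sum_variational (R : realType) (m d : nat) (L : R)
    (f : 'I_m -> 'rV[R]_d -> R) (G : 'rV[R]_d -> \bar R) (xs : 'rV[R]_d) :
  (forall i, smooth L (f i)) -> proper_function G -> convex_efunction G ->
  argmin (fun x => ((m%:R)^-1 * \sum_(i < m) f i x)%:E + G x)%E xs ->
  forall y b, G y = b%:E -> exists2 a, G xs = a%:E &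
    a <= b + mdot (m%:R^-1 *: \sum_(i < m) gradient (f i) xs) (y - xs).
Proof.
move=> f_smooth [GNy _] Gconv xs_opt.
apply: (@argmin_variational _ _ _ (fun x => (m%:R)^-1 * \sum_(i < m) f i x)
  G xs _ (m%:R^-1 * \sum_(i < m) (L / 2))) => //.
- move=> v; rewrite mdotZl -mulrA -!mulrDr ler_wpM2l ?invr_ge0 ?ler0n//.
  have -> : mdot (\sum_i gradient (f i) xs) v
      = \sum_i mdot (gradient (f i) xs) v.
    rewrite mdotC /mdot mulmx_sumr raddf_sum.
    by apply: eq_bigr => i _; exact: mdotC.
  rewrite mulr_suml -!big_split/=; apply: ler_sum => i _.
  exact: smooth_upper.
- move=> y a b t Gx Gy t0 t1.
  by apply: convex_efunction_line; rewrite ?Gx ?Gy// ltW.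
Qed.

(** The hypothesis on [p] says that [-p] is a subgradient of [G] at [xs], so [ones *m xs] is the
    proximal point of [ones *m (xs - gamma *: p)]. Adding it row by row to the inequality for [X]
    gives [|x|^2 <= <z, x>], and [|z - x|^2 >= 0] concludes. *)
Lemma prox_consensus_nonexpansive (R : realType) (m d : nat) (gamma : R)
    (G : 'rV[R]_d -> \bar R) (xs p : 'rV[R]_d) (Z X : 'M[R]_(m, d)) :
  0 < gamma -> proper_function G -> convex_efunction G ->
  (forall y b, G y = b%:E ->
     exists2 a, G xs = a%:E & a <= b + mdot p (y - xs)) ->
  prox gamma (rowsum G) Z X ->
  mdot (X - ones *m xs) (X - ones *m xs)
    <= mdot (Z - ones *m (xs - gamma *: p)) (Z - ones *m (xs - gamma *: p)).
Proof.
move=> gamma_gt0 G_proper G_conv xs_opt XZ; have [GNy [y0 Gy0]] := G_proper.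
have [c Gxs] : exists c, G xs = c%:E.
  move: (GNy y0) Gy0; case Gy : (G y0) => [b||]// _ _.
  by have [c -> _] := xs_opt _ _ Gy; exists c.
have GXs : rowsum G ((ones : 'cV[R]_m) *m xs) = (\sum_(i < m) c)%:E.
  by apply: rowsum_fin => i; rewrite row_ones.
have [a GX aX] := prox_variational gamma_gt0 G_proper G_conv XZ GXs.
have [al Gal aE] := rowsumP GNy GX.
have ca : \sum_(i < m) c <= a + mdot (ones *m p) (X - ones *m xs).
  rewrite aE mdot_row -big_split/=; apply: ler_sum => i _.
  have [c' ] := xs_opt _ _ (Gal i).
  by rewrite Gxs => -[->]; rewrite linearB/= !row_ones.
set x := X - ones *m xs in ca *; set z := Z - _.
have zE : Z - X = z - x - gamma *: (ones *m p).
  rewrite /z /x mulmxBr -scalemxAr opprB; apply/matrixP => i j.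
  by rewrite !mxE; ring.
have : mdot x x <= mdot z x.
  have gV_gt0 : 0 < gamma^-1 by rewrite invr_gt0.
  rewrite -subr_ge0 -(pmulr_rge0 _ gV_gt0).
  have : mdot (Z - X) (ones *m xs - X) = mdot x x - mdot z x
      + gamma * mdot (ones *m p) x.
    rewrite -[ones *m xs - X]opprB -/x zE; clearbody x z.
    by rewrite !mdotL; ring.
  move=> ZXE; move: aX; rewrite ZXE mulrDr mulKf ?gt_eqF//; move: ca; lra.
have := mdot_ge0 (z - x).
clearbody x z; rewrite !mdotL (mdotC x z); lra.
Qed.

(** This step-size balances the two extremes: [1 - gamma L] and [1 - gamma mu] are opposite
    numbers. *)
Lemma contraction_factorE (R : realType) (mu L : R) (gamma := 2 / (L + mu))
    (kappa := L / mu) : 0 < mu -> mu <= L ->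
  Num.max `|1 - gamma * L| `|1 - gamma * mu| = (kappa - 1) / (kappa + 1) /\
  (kappa - 1) / (kappa + 1) = (L - mu) / (L + mu).
Proof.
move=> mu0 muL; have Lmu : 0 < L + mu by lra.
have r0 : 0 <= (L - mu) / (L + mu) by rewrite divr_ge0 ?subr_ge0// ltW.
have kE : (kappa - 1) / (kappa + 1) = (L - mu) / (L + mu).
  by rewrite /kappa; field; rewrite !gt_eqF.
split=> //; rewrite kE.
have -> : 1 - gamma * L = - ((L - mu) / (L + mu)).
  by rewrite /gamma; field; rewrite gt_eqF.
have -> : 1 - gamma * mu = (L - mu) / (L + mu).
  by rewrite /gamma; field; rewrite gt_eqF.
by rewrite normrN maxxx ger0_norm.
Qed.

Lemma iteration_diff (R : realType) (m d : nat) (gamma : R) (B : 'M[R]_m)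
    (X X' g g' Y Z' : 'M[R]_(m, d)) :
  B *m X - gamma *: (B *m g) - Y - Z'
    = B *m (X - gamma *: g - (X' - gamma *: g'))
      - (Y - (B *m X' - gamma *: (B *m g') - Z')).
Proof.
rewrite !mulmxBr -!scalemxAr.
move: (B *m X) (B *m X') (B *m g) (B *m g') => u u' v v'.
by apply/matrixP => i j; rewrite !mxE; ring.
Qed.

Theorem corollary4 (R : realType) (m d : nat) (mu L : R)
  (m_gt1 : (1 < m)%N) (mu_gt0 : 0 < mu) (mu_le_L : mu <= L)
  (f : 'I_m -> 'rV[R]_d -> R) (G : 'rV[R]_d -> \bar R)
  (f_sconvex : forall i, strongly_convex mu (f i))
  (f_smooth : forall i, smooth L (f i))
  (G_proper : proper_function G)
  (G_closed : closed_function G)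
  (G_convex : convex_efunction G)
  (xstar : 'rV[R]_d)
  (xstar_opt : argmin
     (fun x => ((m%:R)^-1 * \sum_(i < m) f i x)%:E + G x)%E xstar)
  (A B C D : 'M[R]_m)
  (B_sym : B \is symmetricmx)
  (C_psd : psdmx C)
  (cond_a : forall v : 'cV[R]_m, C *m v = 0 <-> exists a : R, v = a *: ones)
  (cond_b1 : (ones^T *m A *m ones) 0 0 = m%:R)
  (cond_b2 : ones^T *m B = ones^T)
  (D_sym : D \is symmetricmx)
  (cond_c1 : A = B *m D)
  (cond_c2 : loewner_lt (- 1%:M) D)
  (cond_c3 : loewner_le D 1%:M)
  (cond_d : loewner_lt 0 (1%:M - C))
  (cond_e : B *m C = C *m B)
  (cond_f : L * eigen_max D - mu * eigen_min D != 0 ->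
     loewner_lt (B *m B)
       ((L + mu) ^+ 2 / (L * eigen_max D - mu * eigen_min D) ^+ 2
          *: (1%:M - C)))
  (B2_le : loewner_le (B *m B) (1%:M - C))
  (A_eq_B : A = B)
  (D_eq_I : D = 1%:M)
  (gamma : R)
  (gamma_opt : gamma = (eigen_max D + eigen_min D) / (L + mu))
  (X Z Y : nat -> 'M[R]_(m, d))
  (Y0_range : forall j : 'I_d, exists w : 'cV[R]_m, col j (Y 0%N) = C *m w)
  (X_iter : forall k, prox gamma (rowsum G) (Z k) (X k))
  (Z_iter : forall k, Z k.+1 =
     A *m X k - gamma *: (B *m stacked_gradient f (X k)) - Y k)
  (Y_iter : forall k, Y k.+1 = Y k + C *m Z k.+1) :
  let kappa := L / mu in
  let q := Num.max `|eigen_min D - gamma * L| `|eigen_max D - gamma * mu| in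
  let lambda :=
    Num.max (q ^+ 2 * eigen_max (B *m B *m invmx (1%:M - C))) (1 - eigen 2 C) in
  [/\ gamma = 2 / (L + mu),
      lambda = Num.max (((kappa - 1) / (kappa + 1)) ^+ 2) (1 - eigen 2 C)
    & ((fun k => frobenius (X k - ones *m xstar) ^+ 2) : nat -> R^o)
        =O_\oo ((fun k => lambda ^+ k) : nat -> R^o)].

Proof.
move=> kappa q lambda.
have n0 : (0 < m)%N := ltnW m_gt1.
have Dmax : eigen_max D = 1.
  by rewrite D_eq_I; apply: eigen_scalar1; rewrite n0 leqnn.
have Dmin : eigen_min D = 1 by rewrite D_eq_I; apply: eigen_scalar1; rewrite n0.
have gammaE : gamma = 2 / (L + mu) by rewrite gamma_opt Dmax Dmin.
have [qE kappaE] := contraction_factorE mu_gt0 mu_le_L.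
have S_pd : pdmx (1%:M - C) by move: cond_d; rewrite /loewner_lt subr0.
have C1 : C *m ones = 0 := mul_ones0 cond_a.
have S1 : (1%:M - C) *m ones = ones by rewrite mulmxBl mul1mx C1 subr0.
have B1 : B *m ones = ones.
  move: (congr1 trmx cond_b2); rewrite trmx_mul trmxK.
  by move: B_sym; rewrite symmetric_tr => /eqP ->.
have BS : B *m (1%:M - C) = (1%:M - C) *m B.
  by rewrite mulmxBr mulmxBl mulmx1 mul1mx cond_e.
have lambdaE :
    lambda = Num.max (((kappa - 1) / (kappa + 1)) ^+ 2) (1 - eigen 2 C).
  by rewrite /lambda eigen_max_schur// mulr1 /q Dmax Dmin gammaE qE.
split=> //.
have gamma_gt0 : 0 < gamma by rewrite gammaE divr_gt0//; lra.
(* [(Xs, Zs, Ys)] is the fixed point: [Ys] is solved from the [Z] update, and [C Zs = 0] keeps [Y]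
   stationary. *)
pose p := m%:R^-1 *: \sum_(i < m) gradient (f i) xstar.
pose Xs : 'M[R]_(m, d) := ones *m xstar.
pose Zs : 'M[R]_(m, d) := ones *m (xstar - gamma *: p).
pose Ys := B *m Xs - gamma *: (B *m stacked_gradient f Xs) - Zs.
have CZs : C *m Zs = 0 by rewrite /Zs mulmxA C1 mul0mx.
(* As [1^T B = 1^T] and the gradients sum to [m p], the column sums are [m (xstar - gamma p) - m
   (xstar - gamma p)]. *)
have Ys1 : ones^T *m Ys = 0.
  have gE : ones^T *m stacked_gradient f Xs = m%:R *: p.
    rewrite scalerA divff ?scale1r ?pnatr_eq0 -?lt0n//.
    apply/rowP => j; rewrite ones_tr_mul summxE; apply: eq_bigr => i _.
    by rewrite mxE row_ones.
  rewrite !mulmxBr -scalemxAr !(mulmxA _ B) cond_b2 gE !mulmxA ones_tr_ones.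
  rewrite !mul_scalar_mx scalerBr !scalerA (mulrC gamma).
  exact: subrr.
have Y01 : ones^T *m Y 0%N = 0.
  apply/matrixP => i j; have [w Yw] := Y0_range j.
  have -> : (ones^T *m Y 0%N) i j = (ones^T *m col j (Y 0%N)) i 0.
    by rewrite colE mulmxA -colE [RHS]mxE.
  by rewrite Yw (ones_tr_mulC C_psd cond_a) !mxE.
have [P0 CP0] : exists P, Y 0%N - Ys = C *m P.
  by apply: (consensus_range C_psd cond_a); rewrite mulmxBr Y01 Ys1 subr0.
(* Summing the [Z] errors produces a preimage of [Y k - Ys] under [C] for every [k]. *)
pose P k := P0 + \sum_(i < k) (Z i.+1 - Zs).
have PS k : P k.+1 = P k + (Z k.+1 - Zs) by rewrite /P big_ord_recr/= addrA.
have CP k : C *m P k = Y k - Ys.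
  elim: k => [|k IH]; first by rewrite /P big_ord0 addr0 CP0.
  by rewrite PS mulmxDr IH mulmxBr CZs subr0 Y_iter addrAC.
pose W k := X k - gamma *: stacked_gradient f (X k)
  - (Xs - gamma *: stacked_gradient f Xs).
have ZE k : Z k.+1 - Zs = B *m W k - C *m P k.
  rewrite CP Z_iter A_eq_B /Ys /W.
  exact: iteration_diff.
have X_le k : mdot (X k - Xs) (X k - Xs) <= mdot (Z k - Zs) (Z k - Zs).
  apply: (prox_consensus_nonexpansive gamma_gt0 G_proper G_convex _ (X_iter k)).
  exact: (argmin_sum_variational f_smooth).
have W_le k : mdot (W k) (W k)
    <= ((kappa - 1) / (kappa + 1)) ^+ 2 * mdot (X k - Xs) (X k - Xs).
  rewrite kappaE !mdot_row mulr_sumr; apply: ler_sum => i _.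
  have -> : row i (W k) = row i (X k) - gamma *: gradient (f i) (row i (X k))
      - (row i Xs - gamma *: gradient (f i) (row i Xs)).
    by apply/rowP => j; rewrite !mxE.
  have -> : row i (X k - Xs) = row i (X k) - row i Xs.
    by apply/rowP => j; rewrite !mxE.
  by rewrite gammaE; exact: gradient_step_contraction.
pose l := eigen 2 C.
have l1 : 0 < 1 - l by rewrite subr_gt0 eigen2_lt1.
pose V k := mdot (Z k - Zs) (Z k - Zs) + (1 - l)^-1 * mdot (P k) (C *m P k).
have PCP_ge0 k : 0 <= mdot (P k) (C *m P k) by exact: mdot_psd.
have lambda_ge0 : 0 <= lambda by rewrite lambdaE le_max sqr_ge0.
have VS k : V k.+1 <= lambda * V k.
  rewrite /V PS.
  apply: le_trans
    (lyapunov_step m_gt1 C_psd cond_a S_pd B_sym B2_le (ZE k)) _.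
  (* The summands are compared separately: [|W|^2] is at most the squared contraction factor times
     [|Z - Zs|^2], and [<P, C P>] is [1 - l] times its weighted counterpart in [V]. *)
  rewrite mulrDr lerD//.
    apply: le_trans (W_le k) _.
    apply: le_trans (ler_wpM2l (sqr_ge0 _) (X_le k)) _.
    by rewrite ler_wpM2r ?mdot_ge0// lambdaE le_max lexx.
  rewrite mulrA -[leLHS]mul1r ler_wpM2r// ler_pdivlMr// mul1r.
  by rewrite lambdaE le_max lexx orbT.
have V0 : 0 <= V 0%N.
  by rewrite addr_ge0 ?mdot_ge0// mulr_ge0// invr_ge0 ltW.
have V_le k : V k <= lambda ^+ k * V 0%N.
  elim: k => [|k IH]; first by rewrite expr0 mul1r.
  by rewrite exprS -mulrA (le_trans (VS k))// ler_wpM2l.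
(* The added 1 makes the constant positive even if [V 0] vanishes. *)
apply/eqO_exP; exists (V 0%N + 1); first by rewrite ltr_wpDl.
apply: nearW => k; rewrite frobenius_sqr.
rewrite !ger0_norm ?exprn_ge0 ?mdot_ge0//.
apply: le_trans (X_le k) _; apply: le_trans (_ : V k <= _).
  by rewrite lerDl mulr_ge0// invr_ge0 ltW.
apply: le_trans (V_le k) _; rewrite mulrC ler_wpM2r ?exprn_ge0//.
by rewrite lerDl.
Qed.
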